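(* Let $\mathcal{C}\subseteq\mathbb{R}^n$ be nonempty, compact and convex, and let $F:\mathcal{C}\to\mathbb{R}^n$ be $C^1$ and $\mu$-strongly monotone for some $\mu>0$. Then the solution set $\mathcal{S}=\{x\in\mathcal{C}:\langle F(x),z-x\rangle\ge 0\ \ \forall z\in\mathcal{C}\}$ is a singleton.
   Context: $\|\cdot\|$ is the Euclidean norm and $\langle\cdot,\cdot\rangle$ the Euclidean inner product on $\mathbb{R}^n$. $F$ is $\mu$-strongly monotone if $\langle F(x)-F(y),x-y\rangle\ge\mu\|x-y\|^2$ for all $x,y\in\mathcal{C}$. *)

(* Defs.v *)
From HB Require Import structures.
From mathcomp Require Import all_boot all_order all_algebra.
From mathcomp Require Import all_classical all_reals all_analysis.
Set Implicit Arguments.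
Unset Strict Implicit.
Unset Printing Implicit Defensive.
Import Order.TTheory GRing.Theory Num.Theory.
Import numFieldNormedType.Exports.
Local Open Scope classical_set_scope.
Local Open Scope ring_scope.

Definition dot (R : realType) (n : nat) (u v : 'rV[R]_n) : R :=
  \sum_(i < n) u ord0 i * v ord0 i.

(* The library norm `|u| on 'rV[R]_n is the sup norm; it induces the Euclidean
   topology but is not the Euclidean norm. *)
Definition enorm (R : realType) (n : nat) (u : 'rV[R]_n) : R :=
  Num.sqrt (dot u u).

(* C^1 regularity of a map given on C only, where C may have empty interior:
   each x in C has a derivative J x relative to C, chosen continuously on C.
   Vectors are rows, so J x acts on the right.  The values of F outside C are
   irrelevant.  Any map that agrees on C with a C^1 map on an open neighbourhood
   of C qualifies (C1_on_open); conversely, for C compact and convex, such an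
   extension exists by Whitney's theorem. *)
Definition C1_on (R : realType) (n : nat) (C : set 'rV[R]_n)
    (F : 'rV[R]_n -> 'rV[R]_n) : Prop :=
  exists2 J : 'rV[R]_n -> 'M[R]_n,
    {within C, continuous J} &
    forall x, C x -> forall y,
      F y = F x + (y - x) *m J x +o_(y \near within C (nbhs x)) (y - x).

Lemma C1_on_open (R : realType) (n : nat) (C U : set 'rV[R]_n)
    (F G : 'rV[R]_n -> 'rV[R]_n) :
  open U -> C `<=` U -> {in C, F =1 G} ->
  (forall x, U x -> differentiable G x) ->
  (forall x, U x -> {for x, continuous (jacobian G)}) ->
  C1_on C F.
Proof.
move=> oU CU FG dG cJ; exists (jacobian G).
  apply: continuous_in_subspaceT => x /set_mem Cx; exact/cJ/CU.
move=> x Cx.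
pose W : set_system 'rV[R]_n := within C (nbhs x).
suff : F = (fun y => F x + (y - x) *m jacobian G x) +o_W (fun y => y - x).
  by rewrite funeqE.
apply/eqaddoP => e e0.
have /diff_locally/eqaddoP/(_ _ e0) dGx := dG _ (CU _ Cx).
have xx : y - x @[y --> x] --> (0 : 'rV[R]_n).
  by apply/(@subr_cvg0 _ _ _ _ (nbhs_filter x)) => A; apply.
have := xx _ dGx; apply: (@filterS _ (nbhs x)) => y /= + Cy.
by rewrite !fctE /= ?opprD ?addrA subrK -!FG ?inE// /jacobian mul_rV_lin1.
Qed.

Definition strongly_monotone (R : realType) (n : nat) (C : set 'rV[R]_n)
    (mu : R) (F : 'rV[R]_n -> 'rV[R]_n) : Prop :=
  forall x y, C x -> C y ->
    mu * enorm (x - y) ^+ 2 <= dot (F x - F y) (x - y).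

Definition VI_solutions (R : realType) (n : nat) (C : set 'rV[R]_n)
    (F : 'rV[R]_n -> 'rV[R]_n) : set 'rV[R]_n :=
  [set x | C x /\ forall z, C z -> 0 <= dot (F x) (z - x)].

(* Main.v *)
Require Import Defs.
From mathcomp Require Import all_boot all_order all_algebra.
From mathcomp Require Import all_classical all_reals all_analysis.
From mathcomp Require Import ring lra.
Set Implicit Arguments.
Unset Strict Implicit.
Unset Printing Implicit Defensive.
Import Order.TTheory GRing.Theory Num.Theory.
Import numFieldNormedType.Exports.
Local Open Scope classical_set_scope.
Local Open Scope ring_scope.

(** Let P be the Euclidean projection onto C.  By the obtuse angle criterion,
    x solves the variational inequality exactly when P (x - F x) = x, so
    existence is a fixed point problem.  Instead of a fixed point theorem, the
    proof minimizes the regularized gap function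
      g x = max over z in C of <F x, x - z> - |x - z|^2 / 2,
    whose maximum is attained at z = P (x - F x).  It is continuous, because
    F and P are, so it has a minimizer x on the compact set C.

    Suppose that the direction d = P (x - F x) - x is nonzero.  A step of size
    s towards P (x - F x) stays in C by convexity.  To first order in s it
    changes g by at most s (<F x, d> + |d|^2) - <F (x + s d) - F x, d>.
    The first term is at most 0 by the obtuse angle criterion, and the second
    is at most - s mu |d|^2 by strong monotonicity.  Everything else is at most
    a constant times s^2 |d|^2 (regularized_gap_step), since P is nonexpansive
    and differentiability of F at x makes F (x + s d) - F x of order s |d|.  So
    a small step decreases g, a contradiction (regularized_gap_min_fixed).

    Uniqueness is the usual argument: adding the inequalities that two
    solutions x and y satisfy against each other gives
    <F x - F y, x - y> <= 0, hence x = y by strong monotonicity. *)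

(** * The Euclidean inner product and its comparison with the sup norm *)

Section Dot.
Context {R : realType} {n : nat}.
Implicit Types u v w : 'rV[R]_n.

Lemma dotC u v : dot u v = dot v u.
Proof. by apply: eq_bigr => i _; rewrite mulrC. Qed.

Lemma dotDl u v w : dot (u + v) w = dot u w + dot v w.
Proof. by rewrite -big_split; apply: eq_bigr => i _; rewrite mxE mulrDl. Qed.

Lemma dotNl u v : dot (- u) v = - dot u v.
Proof. by rewrite -sumrN; apply: eq_bigr => i _; rewrite mxE mulNr. Qed.

Lemma dotZl a u v : dot (a *: u) v = a * dot u v.
Proof. by rewrite mulr_sumr; apply: eq_bigr => i _; rewrite mxE mulrA. Qed.

Lemma dotDr u v w : dot w (u + v) = dot w u + dot w v.
Proof. by rewrite !(dotC w) dotDl. Qed.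

Lemma dotNr u v : dot u (- v) = - dot u v.
Proof. by rewrite !(dotC u) dotNl. Qed.

Lemma dotZr a u v : dot u (a *: v) = a * dot u v.
Proof. by rewrite !(dotC u) dotZl. Qed.

Definition dotE := (dotDl, dotDr, dotNl, dotNr, dotZl, dotZr).

Lemma dot_ge0 u : 0 <= dot u u.
Proof. by apply: sumr_ge0 => i _; rewrite -expr2 sqr_ge0. Qed.

Lemma dot_eq0 u : dot u u = 0 -> u = 0.
Proof.
move/eqP; rewrite psumr_eq0 => [|i _]; last by rewrite -expr2 sqr_ge0.
move=> /allP u0; apply/rowP => i; rewrite mxE; apply/eqP.
by have := u0 i (mem_index_enum i); rewrite mulf_eq0 orbb.
Qed.

Lemma sqr_enorm u : enorm u ^+ 2 = dot u u.
Proof. exact/sqr_sqrtr/dot_ge0. Qed.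

(** Replaces the Cauchy-Schwarz inequality in the estimates below, so that
    they are linear in inner products and square roots do not appear. *)
Lemma dot_mul2_le u v : 2 * dot u v <= dot u u + dot v v.
Proof. by have := dot_ge0 (u - v); rewrite !dotE (dotC v u); lra. Qed.

Lemma dot_addr_le u v : dot (u + v) (u + v) <= 2 * (dot u u + dot v v).
Proof. by have := dot_mul2_le u v; rewrite !dotE (dotC v u); lra. Qed.

Lemma coord_le_norm m p (M : 'M[R]_(m, p)) i j : `|M i j| <= `|M|.
Proof.
rewrite [`|M|]mx_normrE.
exact: (le_bigmax _ (fun ij : 'I_m * 'I_p => `|M ij.1 ij.2|) (i, j)).
Qed.

Lemma norm_le_coord m p (M : 'M[R]_(m, p)) c :
  0 <= c -> (forall i j, `|M i j| <= c) -> `|M| <= c.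
Proof. by move=> c0 Mc; rewrite [`|M|]mx_normrE; apply: bigmax_le. Qed.

Lemma dot_le_norm u : dot u u <= n%:R * `|u| ^+ 2.
Proof.
rewrite -[n in n%:R]card_ord -sum1_card natr_sum mulr_suml.
apply: ler_sum => i _.
rewrite mul1r -expr2 -[u _ _ ^+ 2]real_normK ?num_real//.
by rewrite lerXn2r ?nnegrE// coord_le_norm.
Qed.

Lemma norm_le_dot u : `|u| ^+ 2 <= dot u u.
Proof.
have [->|/mx_norm_neq0[[a i] /= ui]] := eqVneq `|u| 0.
  by rewrite expr0n dot_ge0.
rewrite [`|u|]ui (ord1 a) real_normK ?num_real// /dot (bigD1 i)//= -expr2 lerDl.
by apply: sumr_ge0 => j _; rewrite -expr2 sqr_ge0.
Qed.

Lemma norm_mulmx_le u (J : 'M[R]_n) : `|u *m J| <= n%:R * `|J| * `|u|.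
Proof.
apply: norm_le_coord => [|i j]; first by rewrite !mulr_ge0.
rewrite mxE (le_trans (ler_norm_sum _ _ _))//.
rewrite -[n in n%:R]card_ord -sum1_card natr_sum !mulr_suml.
apply: ler_sum => k _; rewrite mul1r normrM mulrC.
by rewrite ler_pM ?coord_le_norm.
Qed.

Lemma near_norm_lt u e : 0 < e -> \forall v \near u, `|u - v| < e.
Proof.
by move=> e0; apply/nbhs_ballP; exists e => // v; rewrite mx_norm_ball.
Qed.

Lemma cvg_dot {T} (G : set_system T) {FG : Filter G} (f g : T -> 'rV[R]_n)
    (a b : 'rV[R]_n) :
  f @ G --> a -> g @ G --> b -> dot (f t) (g t) @[t --> G] --> dot a b.
Proof.
move=> fa gb; apply: (@cvg_big _ _ +%R) => [|i _].
  exact: add_continuous.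
apply: cvgM.
  exact: (cvg_comp _ _ fa (@coord_continuous R 1 n ord0 i a)).
exact: (cvg_comp _ _ gb (@coord_continuous R 1 n ord0 i b)).
Qed.

Lemma cvg_dot_sub_half {T} (G : set_system T) {FG : Filter G}
    (f g : T -> 'rV[R]_n) (a b : 'rV[R]_n) :
  f @ G --> a -> g @ G --> b ->
  dot (f t) (g t) - dot (g t) (g t) / 2 @[t --> G] --> dot a b - dot b b / 2.
Proof.
move=> fa gb; apply: cvgB; first exact: cvg_dot.
by apply: cvgM; [exact: cvg_dot|exact: cvg_cst].
Qed.

Lemma convex_set_line {C : set 'rV[R]_n} x y s : convex_set C -> C x -> C y ->
  0 <= s <= 1 -> C (x + s *: (y - x)).
Proof.
move=> cC Cx Cy /andP[s0 s1].
have s01 : Itv.spec (Itv.num_sem (R := R)) (Itv.Real `[0%Z, 1%Z]) s.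
  by rewrite /= /Itv.num_sem/= num_real in_itv/= s0 s1.
have := cC y x (Itv.mk s01) (mem_set Cy) (mem_set Cx).
rewrite inE /conv /=.
by congr C; rewrite /= scalerBr scalerBl scale1r addrCA addrA addrC.
Qed.

End Dot.

(** * Pointwise Lipschitz maps *)

Lemma lipschitz_at_cvg {R : realType} {n : nat} {C : set 'rV[R]_n}
    (f : 'rV[R]_n -> 'rV[R]_n) (x : 'rV[R]_n) :
    (exists2 L : R, 0 <= L &
      \forall y \near within C (nbhs x), `|f y - f x| <= L * `|y - x|) ->
  f y @[y --> within C (nbhs x)] --> f x.
Proof.
case=> L L0 fL.
apply/cvgrPdist_lt => e e0; near=> y.
rewrite distrC; apply: (@le_lt_trans _ _ (L * `|y - x|)); first by near: y.
apply: (@le_lt_trans _ _ ((L + 1) * `|y - x|)).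
  by rewrite ler_wpM2r//; lra.
rewrite mulrC -ltr_pdivlMr; last lra.
rewrite distrC; near: y.
have /near_norm_lt : 0 < e / (L + 1) by rewrite divr_gt0//; lra.
by move=> /(_ n x); apply: (@filterS _ (nbhs x)) => y.
Unshelve. all: by end_near. Qed.

(** * Projection onto a compact convex set *)

Section Projection.
Context {R : realType} {n : nat} {C : set 'rV[R]_n}.
Hypotheses (C_nonempty : C !=set0) (C_compact : compact C)
  (C_convex : convex_set C).

(** First-order optimality: moving from h towards z by a fraction s cannot
    decrease the distance to p, so 2 <p - h, z - h> <= s |z - h|^2 for every
    s in ]0, 1]. *)
Lemma nearest_point_obtuse p h z : C h ->
    (forall y, C y -> dot (h - p) (h - p) <= dot (y - p) (y - p)) ->
  C z -> dot (p - h) (z - h) <= 0.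
Proof.
move=> Ch hmin Cz.
suff main s : 0 < s <= 1 ->
    2 * dot (p - h) (z - h) <= s * dot (z - h) (z - h).
  set b := dot _ _ in main *; set c := dot _ _ in main *.
  have c0 : 0 <= c := dot_ge0 _.
  (* The fraction b / (b + c) lies in ]0, 1] and is too small for main when
     0 < b; the sum b + c avoids dividing by c, which may vanish. *)
  rewrite leNgt; apply/negP => b0.
  have bc0 : 0 < b + c by lra.
  have /main : 0 < b / (b + c) <= 1.
    by rewrite divr_gt0// ler_pdivrMr// mul1r; lra.
  by rewrite mulrAC ler_pdivlMr//; nra.
move=> /andP[s0 s1].
have /hmin : C (h + s *: (z - h)) by apply: convex_set_line; rewrite // ltW.
have -> : h + s *: (z - h) - p = s *: (z - h) - (p - h).
  by rewrite [h + _]addrC -addrA opprB.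
rewrite -(opprB p h); move: (p - h) (z - h) => u v.
rewrite !dotE (dotC v u) => suv; rewrite -(ler_pM2l s0); lra.
Qed.

Lemma exists_projection : {P : 'rV[R]_n -> 'rV[R]_n |
  forall p, C (P p) /\ forall z, C z -> dot (p - P p) (z - P p) <= 0}.
Proof.
suff /choice[P PP] : forall p : 'rV[R]_n, exists h,
    C h /\ forall z, C z -> dot (p - h) (z - h) <= 0 by exists P.
move=> p.
have cont : {within C, continuous (fun y => dot (y - p) (y - p))}.
  apply: continuous_subspaceT => y.
  have cy : y' @[y' --> y] --> (y : 'rV[R]_n) := cvg_id.
  have subp : y' - p @[y' --> y] --> y - p by exact: (cvgB cy (cvg_cst p)).
  exact: (cvg_dot subp subp).
have [h /set_mem Ch hmin] := compact_EVT_min C_nonempty C_compact cont.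
exists h; split=> // z; apply: nearest_point_obtuse => // y Cy.
exact/hmin/mem_set.
Qed.

End Projection.

Section ProjectionTheory.
Context {R : realType} {n : nat} {C : set 'rV[R]_n} {P : 'rV[R]_n -> 'rV[R]_n}.
Hypothesis PP :
  forall p, C (P p) /\ forall z, C z -> dot (p - P p) (z - P p) <= 0.

Lemma projection_nonexpansive p q :
  dot (P q - P p) (P q - P p) <= dot (q - p) (q - p).
Proof.
have [Cp /(_ (P q)) hp] := PP p; have [Cq /(_ (P p)) hq] := PP q.
(* The sum of the two obtuse angle inequalities is
   |P q - P p|^2 <= <q - p, P q - P p>. *)
have := hp Cq; have := hq Cp; have := dot_ge0 (q - p - (P q - P p)).
rewrite !dotE !(dotC (P p)) !(dotC (P q) q) !(dotC (P q) p) (dotC q p).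
lra.
Qed.

Lemma projection_lipschitz p q : `|P q - P p| <= n.+1%:R * `|q - p|.
Proof.
rewrite -(@ler_pXn2r _ 2) ?nnegrE ?mulr_ge0//.
apply: le_trans (norm_le_dot _) _.
apply: le_trans (projection_nonexpansive _ _) _.
apply: le_trans (dot_le_norm _) _.
rewrite exprMn ler_wpM2r ?exprn_ge0// -natrX ler_nat.
by rewrite (leq_trans (leqnSn n))// expnS leq_pmulr.
Qed.

End ProjectionTheory.

(** * Consequences of differentiability *)

Section Regularity.
Context {R : realType} {n : nat} {C : set 'rV[R]_n} {F : 'rV[R]_n -> 'rV[R]_n}.
Hypothesis F_C1 : C1_on C F.

(** The linear part of the expansion of F at x is bounded by a multiple of
    |y - x|, and the remainder is eventually at most |y - x|. *)
Lemma C1_on_lipschitz_at {x} : C x -> exists2 L : R, 0 <= L &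
  \forall y \near within C (nbhs x), `|F y - F x| <= L * `|y - x|.
Proof.
case: F_C1 => J _ FJ Cx; exists (n%:R * `|J x| + 1).
  by rewrite addr_ge0// mulr_ge0.
have FxJ := FJ x Cx.
set W := within _ _.
have {FxJ} : F = (fun y => F x + (y - x) *m J x) +o_W (fun y => y - x).
  by rewrite funeqE.
move=> /eqaddoP/(_ 1 ltr01).
apply: filterS => y /=; rewrite !fctE mul1r => Fy.
have -> : F y - F x = (y - x) *m J x + (F y - (F x + (y - x) *m J x)).
  by rewrite [RHS]addrC opprD addrA subrK.
apply: le_trans (ler_normD _ _) _.
by rewrite mulrDl mul1r lerD// norm_mulmx_le.
Qed.

End Regularity.

(** * The regularized gap function *)

Section Gap.
Context {R : realType} {n : nat}.

(** The maximum over z in C of <F x, x - z> - |x - z|^2 / 2, written with its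
    maximizer z = P (x - F x) when P is the projection onto C. *)
Definition regularized_gap (F P : 'rV[R]_n -> 'rV[R]_n) (x : 'rV[R]_n) : R :=
  let d := x - P (x - F x) in dot (F x) d - dot d d / 2.

Context {C : set 'rV[R]_n} {F P : 'rV[R]_n -> 'rV[R]_n}.
Hypothesis PP :
  forall p, C (P p) /\ forall z, C z -> dot (p - P p) (z - P p) <= 0.

(** Completing the square turns the maximized expression into
    |F x|^2 / 2 - |z - (x - F x)|^2 / 2, so the maximizer is the point of C
    nearest to x - F x. *)
Lemma regularized_gap_max x z : C z ->
  dot (F x) (x - z) - dot (x - z) (x - z) / 2 <= regularized_gap F P x.
Proof.
move=> Cz; have [_ /(_ _ Cz)] := PP (x - F x).
rewrite /regularized_gap; move: (P (x - F x)) => h; move: (F x) => f.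
have := dot_ge0 (z - h).
rewrite !dotE ?(dotC z h) ?(dotC h x) ?(dotC z x) ?(dotC h f) ?(dotC z f).
rewrite ?(dotC x f); lra.
Qed.

(** Danskin's argument: the gap at x + s d is evaluated at its own maximizer
    hs, and the gap at x is bounded below by its value at the same hs.
    With w the increment of F and k that of the projected point, the
    difference between that gap and this lower bound is
      s (<F x, d> + |d|^2) + s <w, d> - <w, d> - <w, k> + s <d, k>
        - s^2 |d|^2 / 2,
    where |w|^2 and |k|^2 are of order s^2 |d|^2. *)
Lemma regularized_gap_step x (s mu L : R) (d := P (x - F x) - x)
    (w := F (x + s *: d) - F x) :
  C x -> 0 < s ->
  mu * s * dot d d <= dot w d ->
  dot w w <= L * s ^+ 2 * dot d d ->
  regularized_gap F P (x + s *: d) <=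
    regularized_gap F P x - s * (mu - s * 3 * (L + 1)) * dot d d.
Proof.
move=> Cx s0 wd ww.
have [_ /(_ _ Cx)] := PP (x - F x).
set hs := P (x + s *: d - F (x + s *: d)).
have [Chs _] : C hs /\ _ := PP _.
have := @regularized_gap_max x _ Chs.
have := projection_nonexpansive PP (x - F x) (x + s *: d - F (x + s *: d)).
rewrite [X in _ -> _ -> _ -> X <= _]/regularized_gap -/hs.
have -> : F (x + s *: d) = F x + w by rewrite /w [RHS]addrC subrK.
have -> : x + s *: d - hs = (s - 1) *: d - (hs - P (x - F x)).
  by rewrite /d; apply/rowP => i; rewrite !mxE; ring.
have -> : x - hs = - d - (hs - P (x - F x)).
  by rewrite /d; apply/rowP => i; rewrite !mxE; ring.
have -> : x + s *: d - (F x + w) - (x - F x) = s *: d - w.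
  by apply/rowP => i; rewrite !mxE; ring.
have -> : x - F x - P (x - F x) = - d - F x.
  by rewrite /d; apply/rowP => i; rewrite !mxE; ring.
have -> : x - P (x - F x) = - d by rewrite opprB.
move: wd ww; move: (hs - _) => k; move: (regularized_gap _ _ x) => g.
move: (F x) => f.
(* From here on, only the inner products of d, w, k and f matter. *)
clear Chs; clearbody hs; move: w => w; move: d => d.
have := dot_mul2_le w (- k); have := dot_mul2_le (s *: d) k.
have := dot_mul2_le w (s *: d); have := dot_addr_le (s *: d) (- w).
rewrite !dotE ?(dotC k d) ?(dotC d w) ?(dotC k w) ?(dotC d f) ?(dotC k f).
move=> kle wsd wk sdk wd ww kk gle fd.
have : 0 <= s * (s * dot d d) by rewrite !mulr_ge0 ?dot_ge0// ltW.
have : s * (dot d d + dot f d) <= 0 by rewrite pmulr_rle0//; lra.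
lra.
Qed.

Hypotheses (C_convex : convex_set C) (F_C1 : C1_on C F).

Lemma regularized_gap_continuous : {within C, continuous (regularized_gap F P)}.
Proof.
apply/subspace_continuousP => /= x Cx.
have FW : Filter (within C (nbhs (x : 'rV[R]_n))) by exact: within_filter.
have cF := lipschitz_at_cvg (C1_on_lipschitz_at F_C1 Cx).
have cP : P (y - F y) @[y --> within C (nbhs x)] --> P (x - F x).
  apply: (@lipschitz_at_cvg _ _ _ (fun y => P (y - F y))).
  have [L L0 FL] := C1_on_lipschitz_at F_C1 Cx.
  exists (n.+1%:R * (1 + L)); first by rewrite mulr_ge0// addr_ge0.
  apply: filterS FL => y Fy; apply: le_trans (projection_lipschitz PP _ _) _.
  rewrite -mulrA ler_wpM2l//.
  have -> : y - F y - (x - F x) = (y - x) - (F y - F x).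
    by rewrite !opprD !opprK addrACA.
  by rewrite mulrDl mul1r (le_trans (ler_normB _ _))// lerD.
have cx : y @[y --> within C (nbhs x)] --> (x : 'rV[R]_n).
  exact: cvg_within.
have cd : y - P (y - F y) @[y --> within C (nbhs x)] --> x - P (x - F x).
  by move: cP; apply: cvgB cx.
exact: (cvg_dot_sub_half cF cd).
Qed.

(** Otherwise a small step towards P (x - F x) decreases the gap. *)
Lemma regularized_gap_min_fixed mu x :
    0 < mu -> strongly_monotone C mu F -> C x ->
    {in C, forall y, regularized_gap F P x <= regularized_gap F P y} ->
  P (x - F x) = x.
Proof.
move=> mu_gt0 F_monotone Cx x_min; have [Ch _] := PP (x - F x).
have [L L0 FL] := C1_on_lipschitz_at F_C1 Cx.
set d := P (x - F x) - x.
suff /dot_eq0/eqP : dot d d = 0 by rewrite subr_eq0 => /eqP.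
apply/eqP; rewrite eq_le dot_ge0 andbT leNgt; apply/negP => d_gt0.
have [e /= e0 xe] : exists2 e : R, 0 < e & forall y, `|x - y| < e -> C y ->
    `|F y - F x| <= L * `|y - x|.
  by have /nbhs_ballP[e e0] := FL; rewrite mx_norm_ball => xe; exists e.
set M := n%:R * L ^+ 2; have M0 : 0 <= M by rewrite mulr_ge0// exprn_ge0.
(* The bounds on s give convexity, closeness to x, and a decrease of the gap
   by the preceding estimate with L := M, respectively. *)
have [s [s0 s1 se smu]] : exists s : R,
    [/\ 0 < s, s < 1, s < e / (`|d| + 1) & s < mu / (3 * (M + 1))].
  have M1 : 0 < 3 * (M + 1) by lra.
  near (0 : R)^'+ => s; exists s; split; near: s.
  - exact: nbhs_right_gt.
  - exact: nbhs_right_lt.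
  - by apply: nbhs_right_lt; rewrite divr_gt0// ltr_wpDl.
  - by apply: nbhs_right_lt; rewrite divr_gt0.
have Cs : C (x + s *: d) by apply: convex_set_line; rewrite // !ltW.
have sd : `|s *: d| < e.
  move: se; rewrite ltr_pdivlMr ?ltr_wpDl// normrZ gtr0_norm//; lra.
have ssdd : s ^+ 2 * dot d d = dot (s *: d) (s *: d).
  by rewrite dotZl dotZr mulrA.
have Fs := xe (x + s *: d); rewrite opprD addNKr normrN in Fs.
have {Fs sd} := Fs sd Cs.
rewrite addrAC subrr add0r => Fs.
have : regularized_gap F P (x + s *: d) <=
    regularized_gap F P x - s * (mu - s * 3 * (M + 1)) * dot d d.
  apply: (regularized_gap_step Cx s0).
    have := F_monotone _ _ Cs Cx.
    rewrite sqr_enorm addrAC subrr add0r -ssdd dotZr => mono.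
    by rewrite -(ler_pM2l s0); lra.
  apply: le_trans (dot_le_norm _) _.
  rewrite -mulrA ssdd /M -mulrA ler_wpM2l//.
  apply: le_trans (_ : (L * `|s *: d|) ^+ 2 <= _).
    by rewrite lerXn2r ?nnegrE ?mulr_ge0.
  by rewrite exprMn ler_wpM2l ?exprn_ge0// norm_le_dot.
have /x_min := mem_set Cs; move=> /le_trans/[apply].
apply/negP; rewrite -ltNge gtrBl !mulr_gt0//.
by move: smu; rewrite ltr_pdivlMr; lra.
Unshelve. all: by end_near. Qed.

End Gap.

(** * The variational inequality *)

Lemma VI_solution_unique (R : realType) (n : nat) (C : set 'rV[R]_n)
    (F : 'rV[R]_n -> 'rV[R]_n) (mu : R) (x y : 'rV[R]_n) :
    0 < mu -> strongly_monotone C mu F ->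
  VI_solutions C F x -> VI_solutions C F y -> x = y.
Proof.
move=> mu_gt0 F_monotone [Cx /[swap] [[Cy y_sol]] /(_ _ Cy) Fxy].
have Fyx := y_sol _ Cx; have := F_monotone x y Cx Cy; rewrite sqr_enorm => mono.
apply/eqP; rewrite -subr_eq0; apply/eqP/dot_eq0/eqP.
rewrite eq_le dot_ge0 andbT -(pmulr_rle0 _ mu_gt0).
apply: le_trans mono _.
by move: Fxy Fyx; rewrite -(opprB x y) !(dotNr, dotDl, dotNl); lra.
Qed.

Theorem lemma9 (R : realType) (n : nat) (C : set 'rV[R]_n)
    (F : 'rV[R]_n -> 'rV[R]_n) (mu : R)
    (C_nonempty : C !=set0) (C_compact : compact C) (C_convex : convex_set C)
    (F_C1 : C1_on C F) (mu_gt0 : 0 < mu)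
    (F_monotone : strongly_monotone C mu F) :
  exists x : 'rV[R]_n, VI_solutions C F = [set x].
Proof.
have [P PP] := exists_projection C_nonempty C_compact C_convex.
have gap_cont := regularized_gap_continuous PP F_C1.
have [x /set_mem Cx x_min] := compact_EVT_min C_nonempty C_compact gap_cont.
have Px :=
  regularized_gap_min_fixed PP C_convex F_C1 mu_gt0 F_monotone Cx x_min.
have x_sol : VI_solutions C F x.
  split=> // z Cz; have [_ /(_ _ Cz)] := PP (x - F x).
  by rewrite Px addrAC subrr add0r dotNl oppr_le0.
exists x; apply/seteqP; split=> [y y_sol|_ ->//].
exact: VI_solution_unique mu_gt0 F_monotone y_sol x_sol.
Qed.
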